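(* The Christoffel--Geronimus formula for the perturbed CMV mixed multiple Laurent orthogonal polynomials on the step-line $\check A(z^{-1})$ can be written as follows: for $\ell\in\mathbb N_0$ and $a\in\{1,\dots,p\}$, $$\frac{1}{\tilde N_{G,\ell}}\;\check A^{(a)}_{\ell}(z^{-1})= \frac{\begin{vmatrix} F_{\ell,1}^{(1)}&\cdots&F_{\ell,2d}^{(q)}&A_\ell^{(a)}(z^{-1})\\ \vdots&&\vdots&\vdots\\ F_{\ell+2dq-1,1}^{(1)}&\cdots&F_{\ell+2dq-1,2d}^{(q)}&A_{\ell+2dq-1}^{(a)}(z^{-1})\\ F_{\ell+2dq,1}^{(1)}&\cdots&F_{\ell+2dq,2d}^{(q)}&A_{\ell+2dq}^{(a)}(z^{-1}) \end{vmatrix}}{\begin{vmatrix} F_{\ell,1}^{(1)}&\cdots&F_{\ell,2d}^{(q)}\\ \vdots&&\vdots\\ F_{\ell+2dq-1,1}^{(1)}&\cdots&F_{\ell+2dq-1,2d}^{(q)} \end{vmatrix}},$$ where row $n$ of the $F$-part is $(F_{n,1}^{(1)},\dots,F_{n,2d}^{(1)},\dots,F_{n,1}^{(q)},\dots,F_{n,2d}^{(q)})$ and $$F_{n,j}^{(b)}=C_n^{(b)}(z_{b,j})-\sum_{a'=1}^p\ \prod_{s=1,\,s\neq j}^{2d}(z_{b,j}-z_{b,s})\;m_{b,a',j}\,A_n^{(a')}(z_{b,j}^{-1}).$$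
   Context: Let $p,q,d\in\mathbb N$ and let $\mu=(\mu_{b,a})$ be a $q\times p$ matrix of complex Borel measures with infinite support on the unit circle $\mathbb T=\{|z|=1\}$. Rows and columns of semi-infinite matrices are indexed from $0$. For $r\in\mathbb N$, $Z_{[r]}(z)$ is the $\infty\times r$ matrix obtained by stacking the $r\times r$ blocks $I_r, z^{-1}I_r, zI_r, z^{-2}I_r, z^2I_r,\dots$ (block number $2N$ is $z^NI_r$, block number $2N+1$ is $z^{-N-1}I_r$). Let $W_{[q]}(z)=\mathrm{diag}(W_1(z),\dots,W_q(z))$, where each $W_b$ is a balanced Laurent polynomial $W_b(z)=c_bz^{-d}\prod_{j=1}^{2d}(z-z_{b,j})$ with positive and negative degrees both equal to $d$, the $2dq$ zeros $z_{b,j}$ ($b\in\{1,\dots,q\}$, $j\in\{1,\dots,2d\}$) being simple, all different, and not located on $\mathbb T$. The Geronimus perturbation with singular part is $$\mathrm d\check\mu(z)=W_{[q]}(z)^{-1}\,\mathrm d\mu(z)+\sum_{a=1}^p\sum_{b=1}^q\sum_{j=1}^{2d}E_{b,a}\,m_{b,a,j}\,\delta(z-z_{b,j}),$$ where $m_{b,a,j}\in\mathbb C$, $E_{b,a}$ is the $q\times p$ matrix with $1$ at position $(b,a)$ and zeros elsewhere, and the Dirac deltas act as functionals (evaluation at $z_{b,j}$); thus $W_{[q]}\,\mathrm d\check\mu=\mathrm d\mu$. The moment matrices are $M=\oint_{\mathbb T}Z_{[q]}(z)\,\mathrm d\mu(z)\,Z_{[p]}^\top(z^{-1})$ and $\check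 M=\oint Z_{[q]}(z)\,\mathrm d\check\mu(z)\,Z_{[p]}^\top(z^{-1})$. It is assumed that both have Gauss--Borel factorizations $M=L^{-1}U^{-1}$, $\check M=\check L^{-1}\check U^{-1}$, with $L,\check L$ lower triangular and $U,\check U$ upper triangular semi-infinite matrices with nonzero diagonal entries. Put $A(z^{-1})=Z_{[p]}^\top(z^{-1})U$ and $\check A(z^{-1})=Z_{[p]}^\top(z^{-1})\check U$ (entries $A_n^{(a)},\check A_n^{(a)}$ in row $a$, column $n$). The connection matrix is $N_G=U^{-1}\check U$, so that $A(z^{-1})N_G=\check A(z^{-1})$; it is upper triangular and banded with $2dq$ superdiagonals, and $\tilde N_{G,\ell}=(N_G)_{\ell,\ell+2dq}$ denotes the entries of its highest nonzero superdiagonal. The second kind functions are $C(z)=\oint_{\mathbb T}\frac{1}{z-x}\,\mathrm d\mu(x)\,A(x^{-1})$, a $q\times\infty$ matrix with entries $C_n^{(b)}(z)$ in row $b$, column $n$. The determinant in the denominator is understood to be nonzero.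
   Formalization: The printed formula is false: the left side must have Ǎ_{ℓ+2dq}, with prefactor 1/(N_G)_{ℓ+2dq,ℓ+2dq}, or with 1/Ñ_{G,ℓ} and the denominator rows starting at ℓ+1; and the mass term in F needs the factor c_b z_{b,j}^{-d}. Both corrected forms are proved. *)

(* Defs.v *)
From HB Require Import structures.
From mathcomp Require Import all_boot all_order all_algebra.
From mathcomp Require Import all_classical all_reals all_analysis.
From mathcomp Require Import complex.

Set Implicit Arguments.
Unset Strict Implicit.
Unset Printing Implicit Defensive.

Import Order.TTheory GRing.Theory Num.Theory.
Import numFieldNormedType.Exports.

Local Open Scope classical_set_scope.
Local Open Scope ring_scope.

(* A complex Borel measure on the plane, with C identified with R * R (whose
   product sigma-algebra is the Borel one): its real and imaginary parts are
   finite signed measures, i.e. charges. *)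
Record cmeasure (R : realType) := CMeasure {
  re_part : {charge set (R * R)%type -> \bar R};
  im_part : {charge set (R * R)%type -> \bar R} }.

Definition to_complex (R : realType) (v : (R * R)%type) : complex R :=
  Complex v.1 v.2.

Definition unit_circle (R : realType) : set (R * R)%type :=
  [set v | v.1 ^+ 2 + v.2 ^+ 2 = 1].

Definition on_circle (R : realType) (mu : cmeasure R) : Prop :=
  forall A : set (R * R)%type, measurable A -> A `&` @unit_circle R = set0 ->
    re_part mu A = 0%E /\ im_part mu A = 0%E.

(* The closed support of the total variation |mu|: a set has positive |mu|
   exactly when mu does not vanish on some measurable subset of it. *)
Definition csupport (R : realType) (mu : cmeasure R) : set (R * R)%type :=
  [set x | forall U : set (R * R)%type, nbhs x U ->
     exists A : set (R * R)%type, [/\ measurable A, A `<=` U &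
       re_part mu A <> 0%E \/ im_part mu A <> 0%E]].

(* The Jordan decomposition does not depend on the chosen Hahn decomposition. *)
Definition hahn_pos (R : realType) (nu : {charge set (R * R)%type -> \bar R}) :=
  cid (Hahn_decomposition nu).

Definition hahn_neg (R : realType) (nu : {charge set (R * R)%type -> \bar R}) :=
  cid (svalP (hahn_pos nu)).

Definition charge_int (R : realType) (nu : {charge set (R * R)%type -> \bar R})
    (f : (R * R)%type -> R) : R :=
  \int[jordan_pos (svalP (hahn_neg nu))]_(x in @unit_circle R) f x
  - \int[jordan_neg (svalP (hahn_neg nu))]_(x in @unit_circle R) f x.

Definition circle_int (R : realType) (mu : cmeasure R)
    (f : complex R -> complex R) : complex R :=
  let u v := complex.Re (f (to_complex v)) in
  let w v := complex.Im (f (to_complex v)) in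
  Complex (charge_int (re_part mu) u - charge_int (im_part mu) w)
          (charge_int (re_part mu) w + charge_int (im_part mu) u).

(* Semi-infinite matrices are functions of their indices. *)
Definition lower_triangular (K : fieldType) (T : nat -> nat -> K) : Prop :=
  forall i j, (i < j)%N -> T i j = 0.

Definition upper_triangular (K : fieldType) (T : nat -> nat -> K) : Prop :=
  forall i j, (j < i)%N -> T i j = 0.

(* The product X Y for Y upper triangular, where column j of Y is supported on
   the rows 0, ..., j. *)
Definition mul_upper (K : fieldType) (I : Type) (X : I -> nat -> K)
    (Y : nat -> nat -> K) (i : I) (j : nat) : K :=
  \sum_(k < j.+1) X i k * Y k j.

(* The inverse of a triangular semi-infinite matrix with nonzero diagonal: the
   leading principal truncations of the inverse are the inverses of the
   truncations. *)
Definition tri_inv (K : fieldType) (T : nat -> nat -> K) (i j : nat) : K :=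
  invmx (\matrix_(r < (maxn i j).+1, c < (maxn i j).+1) T r c)
    (inord i) (inord j).

Definition gauss_borel (K : fieldType) (M L U : nat -> nat -> K) : Prop :=
  [/\ lower_triangular L, upper_triangular U,
      (forall n, L n n != 0), (forall n, U n n != 0) &
      forall i j, M i j = mul_upper (tri_inv L) (tri_inv U) i j].

Definition cmv_power (K : fieldType) (k : nat) (z : K) : K :=
  if odd k then z ^- (k./2.+1) else z ^+ k./2.

Definition Zcmv (K : fieldType) (r : nat) (z : K) (n : nat) (c : 'I_r) : K :=
  if (n %% r == c)%N then cmv_power (n %/ r) z else 0.

(* The moment matrix of a q x p matrix of functionals,
   (i, j) |-> sum_(b, a) <J_(b,a), Z_[q](z)_(i,b) Z_[p](z^-1)_(j,a)>. *)
Definition moment (K : fieldType) (p q : nat)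
    (J : 'I_q -> 'I_p -> (K -> K) -> K) (i j : nat) : K :=
  \sum_(b < q) \sum_(a < p) J b a (fun z => Zcmv z i b * Zcmv z^-1 j a).

(* A(w) = Z_[p]^T(w) U, to be evaluated at w = z^-1. *)
Definition Apoly (K : fieldType) (p : nat) (U : nat -> nat -> K) (w : K) :
    'I_p -> nat -> K :=
  mul_upper (fun a k => Zcmv w k a) U.

Definition second_kind (R : realType) (p q : nat)
    (mu : 'I_q -> 'I_p -> cmeasure R) (U : nat -> nat -> complex R)
    (z : complex R) (b : 'I_q) (n : nat) : complex R :=
  \sum_(a < p) circle_int (mu b a)
                 (fun x => (z - x)^-1 * Apoly U x^-1 a n).

Section Perturbation.
Variables (R : realType) (p q d : nat).
Variables (c : 'I_q -> complex R) (zeta : 'I_q -> 'I_(2 * d) -> complex R).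
Variables (mu : 'I_q -> 'I_p -> cmeasure R).
Variables (m : 'I_q -> 'I_p -> 'I_(2 * d) -> complex R).

Definition Wlaurent (b : 'I_q) (z : complex R) : complex R :=
  c b * z ^- d * \prod_(j < 2 * d) (z - zeta b j).

Definition geronimus (b : 'I_q) (a : 'I_p) (f : complex R -> complex R) :
    complex R :=
  circle_int (mu b a) (fun x => f x * (Wlaurent b x)^-1)
  + \sum_(j < 2 * d) m b a j * f (zeta b j).

(* The factor in front of m is the derivative of W_b at its zero zeta_(b,j). *)
Definition Fentry (U : nat -> nat -> complex R) (n : nat) (b : 'I_q)
    (j : 'I_(2 * d)) : complex R :=
  let z := zeta b j in
  second_kind mu U z b n
  - \sum_(a < p) c b * z ^- d * (\prod_(s < 2 * d | s != j) (z - zeta b s))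
                 * m b a j * Apoly U z^-1 a n.

(* mxvec lists the entries row by row: (1,1), ..., (1,2d), ..., (q,2d). *)
Definition Frow (U : nat -> nat -> complex R) (n : nat) :
    'rV[complex R]_(q * (2 * d)) :=
  mxvec (\matrix_(b < q, j < 2 * d) Fentry U n b j).

Definition Fdet (U : nat -> nat -> complex R) (l : nat) : complex R :=
  \det (\matrix_(r < q * (2 * d)) Frow U (l + r)).

Definition FAdet (U : nat -> nat -> complex R) (l : nat) (a : 'I_p)
    (z : complex R) : complex R :=
  \det (row_mx (\matrix_(r < q * (2 * d) + 1) Frow U (l + r))
               (\col_(r < q * (2 * d) + 1) Apoly U z^-1 a (l + r)%N)).

End Perturbation.

(* Main.v *)
Require Import Defs.
From mathcomp Require Import all_boot all_order all_algebra.
From mathcomp Require Import all_classical all_reals all_analysis.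
From mathcomp Require Import complex measurable_realfun.
From mathcomp Require Import ring lra zify.

Set Implicit Arguments.
Unset Strict Implicit.
Unset Printing Implicit Defensive.

Import Order.TTheory GRing.Theory Num.Theory.
Local Open Scope classical_set_scope.
Local Open Scope ring_scope.

(* Write D = 2dq and n = l + D, and let N be the connection matrix. The
   factorization of the perturbed moment matrix makes the perturbed A_n
   orthogonal to every Laurent row Z_i with i < n. Applied to W_b z^k this gives
   N_(k,n) = 0 for k + D < n; applied to W_b(x)/(x - zeta_(b,j)), whose
   W_b-quotient is a Cauchy kernel, it gives sum_k N_(k,n) F_(k,j)^(b) = 0 for
   D <= n. So the column (N_(l,n), ..., N_(n,n)) is a left kernel vector of the
   (D + 1) x D matrix of the F's, and pairing it with the column of the A's gives
   the perturbed A_n; the two ratios are then Cramer's rule for its last and its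
   first coordinate, the sign of the latter being (-1)^D = 1. *)

(** * Products and inverses of triangular semi-infinite matrices *)

Section TriangularInverse.
Variable K : fieldType.
Implicit Types (T X Y Z : nat -> nat -> K).

Definition trunc T (s : nat) : 'M[K]_s := \matrix_(r, c) T r c.

Definition transp T : nat -> nat -> K := fun i j => T j i.

(** Transfers results on upper triangular matrices to lower triangular ones. *)
Lemma tri_inv_transp T i j : tri_inv (transp T) i j = tri_inv T j i.
Proof.
rewrite /tri_inv maxnC.
have -> : (\matrix_(r < (maxn j i).+1, c < (maxn j i).+1) transp T r c) =
          (trunc T (maxn j i).+1)^T by apply/matrixP=> r s; rewrite !mxE.
by rewrite -trmx_inv mxE.
Qed.

Lemma mul_upperE (I : Type) (X : I -> nat -> K) Y i j s :
  upper_triangular Y -> (j < s)%N -> mul_upper X Y i j = \sum_(k < s) X i k * Y k j.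
Proof.
move=> uY js; rewrite /mul_upper (big_ord_widen _ (fun k => X i k * Y k j) js).
rewrite big_mkcond /=; apply: eq_bigr => k _; case: ltnP => // jk.
by rewrite uY ?mulr0.
Qed.

(** Upper triangularity of [Y] gives all inner sums the common range [l < j.+1], so the two finite
    sums can be exchanged. *)
Lemma mul_upperA (I : Type) (X : I -> nat -> K) Y Z i j :
  upper_triangular Y -> upper_triangular Z ->
  mul_upper (mul_upper X Y) Z i j = mul_upper X (mul_upper Y Z) i j.
Proof.
move=> uY uZ; rewrite /mul_upper.
transitivity (\sum_(k < j.+1) \sum_(l < j.+1) X i l * Y l k * Z k j).
  apply: eq_bigr => k _.
  by rewrite -[\sum_(_ < _) _]/(mul_upper X Y i k) (mul_upperE _ _ uY (ltn_ord k)) mulr_suml.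
rewrite exchange_big; apply: eq_bigr => l _; rewrite mulr_sumr.
by apply: eq_bigr => k _; rewrite mulrA.
Qed.

Lemma mul_upper1 (I : Type) (X : I -> nat -> K) i j :
  mul_upper X (fun k l => (k == l)%:R) i j = X i j.
Proof.
rewrite /mul_upper big_ord_recr /= eqxx mulr1 big1 ?add0r// => k _.
by rewrite (ltn_eqF (ltn_ord k)) mulr0.
Qed.

Lemma eq_mul_upper (I : Type) (X X' : I -> nat -> K) Y Y' i j :
  (forall k, X i k = X' i k) -> (forall k, Y k j = Y' k j) ->
  mul_upper X Y i j = mul_upper X' Y' i j.
Proof. by move=> eX eY; apply: eq_bigr => k _; rewrite eX eY. Qed.

Lemma upper_mul_upper X Y : upper_triangular X -> upper_triangular Y ->
  upper_triangular (mul_upper X Y).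
Proof.
move=> uX uY i j ji; rewrite /mul_upper big1// => k _.
by rewrite uX ?mul0r// (leq_trans _ ji)// ltnS -ltnS ltn_ord.
Qed.

Lemma mul_upper_diag X Y i : upper_triangular X ->
  mul_upper X Y i i = X i i * Y i i.
Proof.
by move=> uX; rewrite /mul_upper big_ord_recr /= big1 ?add0r// => k _; rewrite uX ?mul0r.
Qed.

Section Upper.
Variables (T : nat -> nat -> K).
Hypotheses (uT : upper_triangular T) (dT : forall n, T n n != 0).

Lemma trunc_unit s : trunc T s \in unitmx.
Proof.
rewrite unitmxE -det_tr det_trig; last first.
  by apply/is_trig_mxP => i j ij; rewrite !mxE uT.
by rewrite unitfE; apply/prodf_neq0 => i _; rewrite !mxE dT.
Qed.

(** The leading block of the larger inverse is a left inverse of the smaller truncation, because the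
    columns of [T] before [s] vanish from row [s] on. Hence any truncation containing both indices
    computes [tri_inv]. *)
Lemma trunc_inv_sub s s' (ss' : (s <= s')%N) (i j : 'I_s) :
  invmx (trunc T s') (widen_ord ss' i) (widen_ord ss' j) = invmx (trunc T s) i j.
Proof.
pose V := invmx (trunc T s').
pose V' := \matrix_(i < s, j < s) V (widen_ord ss' i) (widen_ord ss' j).
suff e : V' *m trunc T s = 1%:M.
  by rewrite -[invmx (trunc T s)]mul1mx -e mulmxK ?trunc_unit// mxE.
apply/matrixP => {}i {}j; rewrite !mxE.
have := congr1 (fun A : 'M[K]_s' => A (widen_ord ss' i) (widen_ord ss' j)) (mulVmx (trunc_unit s')).
rewrite !mxE /= => H; rewrite -[(i == j)]/(widen_ord ss' i == widen_ord ss' j) -H.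
pose F (k : 'I_s') := V (widen_ord ss' i) k * T k j.
rewrite [RHS](eq_bigr F); last by move=> k _; rewrite !mxE.
rewrite (bigID (fun k : 'I_s' => (k < s)%N)) /= [X in _ = _ + X]big1 ?addr0; last first.
  by move=> k; rewrite -leqNgt => sk; rewrite /F uT ?mulr0// (leq_trans _ sk).
rewrite (big_ord_narrow ss') /=; apply: eq_bigr => k _.
by rewrite !mxE.
Qed.

Lemma tri_invE s (i j : 'I_s) : tri_inv T i j = invmx (trunc T s) i j.
Proof.
have ms : ((maxn i j).+1 <= s)%N by rewrite gtn_max !ltn_ord.
rewrite /tri_inv -[\matrix_(_, _) _]/(trunc T (maxn i j).+1) -(trunc_inv_sub ms).
by congr (invmx _ _ _); apply: val_inj; rewrite /= inordK // ltnS ?leq_maxl ?leq_maxr.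
Qed.

Lemma upper_tri_inv : upper_triangular (tri_inv T).
Proof.
move=> i j; elim/ltn_ind: j => j IH ji.
(* In the entry [(i, j)] of [T^-1 T] the terms with [k < j] vanish by induction and those with
   [k > j] by triangularity, which leaves [tri_inv T i j * T j j = 0]. *)
have := congr1 (fun A : 'M[K]_i.+1 => A ord_max (inord j)) (mulVmx (trunc_unit i.+1)).
have ji1 : (j < i.+1)%N by rewrite ltnW.
rewrite !mxE -val_eqE /= inordK// (gtn_eqF ji).
rewrite (bigD1 (inord j)) //= big1 ?addr0.
  rewrite -tri_invE mxE !inordK//= => /eqP.
  by rewrite mulf_eq0 (negbTE (dT j)) orbF => /eqP.
move=> k; rewrite -val_eqE /= inordK// => kj.
rewrite -tri_invE mxE inordK//=; case: (ltngtP k j) kj => // kj _.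
  by rewrite IH ?mul0r// (ltn_trans kj).
by rewrite uT ?mulr0.
Qed.

Lemma mul_tri_invl i j : mul_upper (tri_inv T) T i j = (i == j)%:R.
Proof.
pose s := (maxn i j).+1.
have is_ : (i < s)%N by rewrite ltnS leq_maxl.
have js : (j < s)%N by rewrite ltnS leq_maxr.
rewrite (mul_upperE _ _ uT js).
have := congr1 (fun A : 'M[K]_s => A (Ordinal is_) (Ordinal js)) (mulVmx (trunc_unit s)).
rewrite !mxE -val_eqE /= => <-; apply: eq_bigr => k _.
by rewrite -tri_invE mxE.
Qed.

Lemma mul_tri_invr i j : mul_upper T (tri_inv T) i j = (i == j)%:R.
Proof.
pose s := (maxn i j).+1.
have is_ : (i < s)%N by rewrite ltnS leq_maxl.
have js : (j < s)%N by rewrite ltnS leq_maxr.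
rewrite (mul_upperE _ _ upper_tri_inv js).
have := congr1 (fun A : 'M[K]_s => A (Ordinal is_) (Ordinal js)) (mulmxV (trunc_unit s)).
rewrite !mxE -val_eqE /= => <-; apply: eq_bigr => k _.
by rewrite -tri_invE mxE.
Qed.

Lemma tri_inv_diag_neq0 n : tri_inv T n n != 0.
Proof.
apply/eqP => e; have /eqP := mul_tri_invl n n.
by rewrite mul_upper_diag ?e ?mul0r ?eqxx 1?eq_sym ?oner_eq0//; exact: upper_tri_inv.
Qed.

End Upper.

Lemma lower_tri_inv T : lower_triangular T -> (forall n, T n n != 0) ->
  lower_triangular (tri_inv T) /\ forall n, tri_inv T n n != 0.
Proof.
move=> lT dT; have uT : upper_triangular (transp T) by move=> i j; apply: lT.
split=> [i j ij|n]; rewrite -tri_inv_transp; first exact: (upper_tri_inv uT dT).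
exact: (tri_inv_diag_neq0 uT dT).
Qed.

End TriangularInverse.

(** * Cramer's rule for a left kernel vector *)

Section Cramer.
Variable K : fieldType.

(** Compares determinants whose sizes are equal but not convertible, such as the size [(s + 1).-1]
    of a minor and [s]. *)
Lemma eq_det_cast s t (A : 'M[K]_s) (B : 'M[K]_t) (e : t = s) :
  (forall i j : 'I_t, A (cast_ord e i) (cast_ord e j) = B i j) -> \det A = \det B.
Proof.
by case: s / e A => A h; congr determinant; apply/matrixP=> i j; rewrite -h !cast_ord_id.
Qed.

Variables (s : nat) (F : nat -> 'rV[K]_s) (y v : nat -> K) (w : K).
Hypothesis vF : \sum_(k < s + 1) v k *: F k = 0.
Hypothesis vy : \sum_(k < s + 1) v k * y k = w.

Let S : 'M[K]_(s + 1) := row_mx (\matrix_r F r) (\col_r y r).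

(* Multiply v S = (0, w) by the adjugate of S. *)
Lemma kernel_row_cofactor (i : 'I_(s + 1)) :
  \det S * v i = w * cofactor S i (rshift s ord0).
Proof.
pose vv : 'rV[K]_(s + 1) := \row_k v k.
have e : vv *m S = row_mx 0 (w%:M).
  rewrite /S mul_mx_row; congr row_mx; apply/rowP => j; rewrite !mxE.
    have := congr1 (fun x : 'rV[K]_s => x 0 j) vF; rewrite summxE mxE => h.
    by rewrite -[RHS]h; apply: eq_bigr => k _; rewrite !mxE.
  by rewrite [j]ord1 eqxx mulr1n -vy; apply: eq_bigr => k _; rewrite !mxE.
have := congr1 (fun x : 'rV[K]_(s + 1) => (x *m \adj S) 0 i) e.
rewrite /= -mulmxA mul_mx_adj mul_mx_scalar !mxE => ->.
rewrite big_split_ord /= big1 ?add0r; last by move=> k _; rewrite row_mxEl mxE mul0r.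
by rewrite big_ord1 row_mxEr !mxE /= mulr1n.
Qed.

Lemma kernel_row_cramer_last :
  \det S * v s = w * \det (\matrix_(r < s) F r).
Proof.
rewrite -[s in v s](addn0 s) -[(s + 0)%N]/(val (rshift s (ord0 : 'I_1))).
rewrite kernel_row_cofactor; congr (_ * _).
(* The bottom right corner carries the sign [(-1) ^ (s + s) = 1] whatever the parity of [s]. *)
rewrite /cofactor /= addnn -mul2n exprM sqrrN expr1n expr1n mul1r.
have e : s = (s + 1).-1 by rewrite addn1.
apply: (eq_det_cast (e := e)) => i j.
rewrite [LHS]mxE [LHS]mxE [RHS]mxE.
have -> : lift (rshift s ord0) (cast_ord e j) = lshift 1 j.
  by apply: val_inj; rewrite /= /bump addn0 leqNgt ltn_ord.
have -> : lift (rshift s ord0) (cast_ord e i) = lshift 1 i.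
  by apply: val_inj; rewrite /= /bump addn0 leqNgt ltn_ord.
by rewrite /S row_mxEl !mxE.
Qed.

Lemma kernel_row_cramer_first : ~~ odd s ->
  \det S * v 0 = w * \det (\matrix_(r < s) F r.+1).
Proof.
move=> os; have s1 : (0 < s + 1)%N by rewrite addn1.
rewrite -[0%N]/(val (Ordinal s1)) kernel_row_cofactor; congr (_ * _).
(* The top right corner carries the sign [(-1) ^ s], which is 1 for even [s]. *)
rewrite /cofactor /= add0n addn0 -signr_odd (negbTE os) mul1r.
have e : s = (s + 1).-1 by rewrite addn1.
apply: (eq_det_cast (e := e)) => i j.
rewrite [LHS]mxE [LHS]mxE [RHS]mxE.
have -> : lift (rshift s ord0) (cast_ord e j) = lshift 1 j.
  by apply: val_inj; rewrite /= /bump addn0 leqNgt ltn_ord.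
by rewrite /S row_mxEl !mxE.
Qed.

(** If [v 0 = 0], the remaining coordinates form a left kernel vector of an invertible matrix, so
    all of them vanish, including [v s]. *)
Lemma kernel_row_neq0 : v s != 0 -> \det (\matrix_(r < s) F r.+1) != 0 -> v 0 != 0.
Proof.
move=> vs d0; apply/eqP => v0.
have uF : \matrix_(r < s) F r.+1 \in unitmx by rewrite unitmxE unitfE.
have e0 : \row_(k < s) v k.+1 *m (\matrix_(r < s) F r.+1) = 0.
  apply/rowP => j; rewrite !mxE.
  have := congr1 (fun x : 'rV[K]_s => x 0 j) vF; rewrite addn1 big_ord_recl v0 scale0r add0r.
  rewrite summxE !mxE => h; rewrite -[RHS]h; apply: eq_bigr => k _.
  by rewrite !mxE.
(* For [s = 0] the coordinates [v 0] and [v s] coincide, which is already contradictory. *)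
have s0 : (0 < s)%N by rewrite lt0n; apply: contraNneq vs => ->; rewrite v0.
have s1 : (s.-1 < s)%N by rewrite prednK.
have := congr1 (fun x : 'rV[K]_s => (x *m invmx (\matrix_(r < s) F r.+1)) 0 (Ordinal s1)) e0.
by rewrite /= mulmxK// mul0mx !mxE prednK// => /eqP; rewrite (negbTE vs).
Qed.
End Cramer.

Lemma big_ord_shift (V : nmodType) (G : nat -> V) l s :
  (forall k, (k < l)%N -> G k = 0) ->
  \sum_(k < (l + s).+1) G k = \sum_(k < s + 1) G (l + k)%N.
Proof.
move=> G0; rewrite -addn1 -addnA big_split_ord /= big1 ?add0r// => k _.
by rewrite G0.
Qed.

(** * Linearity of integration over the circle against a complex measure *)

Section CircleIntegral.
Variable R : realType.
Local Notation T := (R * R)%type.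
Local Notation circle := (@unit_circle R).
Local Notation C := (complex R).
Implicit Types (g h : T -> R) (f : C -> C).

Lemma measurable_unit_circle : measurable circle.
Proof.
have -> : circle = setT `&` (fun v : T => v.1 ^+ 2 + v.2 ^+ 2) @^-1` [set 1].
  by rewrite setTI.
apply: (_ : measurable_fun setT _) => //.
by apply: measurable_funD; apply: measurable_funX;
  [exact: measurable_fst|exact: measurable_snd].
Qed.

(* Every integrand of the theorem is rational without poles on the circle, so
   boundedness is enough to get integrability against the finite Jordan parts. *)
Definition bdd_measurable g : Prop :=
  measurable_fun circle g /\ exists M, forall v, circle v -> `|g v| <= M.

Lemma bdd_measurableD g h :
  bdd_measurable g -> bdd_measurable h -> bdd_measurable (fun v => g v + h v).
Proof.
move=> [mg [M gM]] [mh [N hN]]; split; first exact: measurable_funD.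
exists (M + N) => v cv; apply: le_trans (ler_normD _ _) _.
by rewrite lerD ?gM ?hN.
Qed.

Lemma bdd_measurableM g h :
  bdd_measurable g -> bdd_measurable h -> bdd_measurable (fun v => g v * h v).
Proof.
move=> [mg [M gM]] [mh [N hN]]; split; first exact: measurable_funM.
by exists (M * N) => v cv; rewrite normrM ler_pM ?gM ?hN.
Qed.

Lemma bdd_measurable_cst a : bdd_measurable (fun=> a).
Proof. by split; [exact: measurable_cst|exists `|a|]. Qed.

Lemma bdd_measurableN g : bdd_measurable g -> bdd_measurable (fun v => - g v).
Proof.
move=> bg; rewrite (_ : (fun v => - g v) = (fun v => -1 * g v)).
  by apply: bdd_measurableM => //; exact: bdd_measurable_cst.
by apply/funext => v; rewrite mulN1r.
Qed.

Lemma eq_bdd_measurable g h :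
  (forall v, circle v -> g v = h v) -> bdd_measurable g -> bdd_measurable h.
Proof.
move=> gh [mg [M gM]]; split.
  by apply: eq_measurable_fun mg => v /set_mem cv; rewrite gh.
by exists M => v cv; rewrite -gh ?gM.
Qed.

Lemma bdd_measurableV g (e : R) : 0 < e -> (forall v, circle v -> e <= g v) ->
  bdd_measurable g -> bdd_measurable (fun v => (g v)^-1).
Proof.
move=> e0 eg [mg _]; split; last first.
  exists e^-1 => v cv; have gv := eg v cv; have g0 := lt_le_trans e0 gv.
  by rewrite normfV gtr0_norm// lef_pV2// posrE.
(* On positive values the inverse is the real power of exponent -1, which is measurable. *)
apply: (@eq_measurable_fun _ _ _ _ _ (fun v => g v `^ (-1))).
  by move=> v /set_mem cv; rewrite powR_inv1// (le_trans (ltW e0))// eg.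
exact: (measurableT_comp (measurable_powR _)).
Qed.

Lemma circle_le1 (v : T) : circle v -> `|v.1| <= 1 /\ `|v.2| <= 1.
Proof.
rewrite /unit_circle /= => cv; have h1 := sqr_ge0 v.1; have h2 := sqr_ge0 v.2.
by split; rewrite -(@ler_pXn2r _ 2)// ?nnegrE// !real_normK ?num_real// expr1n; lra.
Qed.

Lemma bdd_measurable_fst : bdd_measurable fst.
Proof.
split; first exact: measurable_funTS measurable_fst.
by exists 1 => v /circle_le1[].
Qed.

Lemma bdd_measurable_snd : bdd_measurable snd.
Proof.
split; first exact: measurable_funTS measurable_snd.
by exists 1 => v /circle_le1[].
Qed.

Section Charge.
Variable nu : {charge set (R * R)%type -> \bar R}.

Lemma bdd_measurable_integrable (mu : {finite_measure set T -> \bar R}) g :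
  bdd_measurable g -> mu.-integrable circle (EFin \o g).
Proof.
move=> [mg [M gM]]; apply: measurable_bounded_integrable => //.
- exact: measurable_unit_circle.
- by rewrite ltey_eq fin_num_measure//; exact: measurable_unit_circle.
- exists M; split; first exact: num_real.
  by move=> y My v /gM /le_trans; apply; exact: ltW.
Qed.

Lemma charge_intD g h : bdd_measurable g -> bdd_measurable h ->
  charge_int nu (fun v => g v + h v) = charge_int nu g + charge_int nu h.
Proof.
move=> bg bh; rewrite /charge_int !RintegralD//; first by ring.
all: by [exact: measurable_unit_circle|exact: bdd_measurable_integrable].
Qed.

Lemma charge_intZ a g : bdd_measurable g ->
  charge_int nu (fun v => a * g v) = a * charge_int nu g.
Proof.
move=> bg; rewrite /charge_int !RintegralZl//; first by ring.
all: by [exact: measurable_unit_circle|exact: bdd_measurable_integrable].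
Qed.

Lemma eq_charge_int g h : (forall v, circle v -> g v = h v) ->
  charge_int nu g = charge_int nu h.
Proof.
by move=> gh; rewrite /charge_int; congr (_ - _); apply: eq_Rintegral => v /set_mem/gh.
Qed.
End Charge.

(** The class on which [circle_int] is linear. It is an algebra containing the constants, [x],
    [x^-1] and [(x - z)^-1] for [z] off the circle, from which the integrands below are built. *)
Definition admissible f : Prop :=
  bdd_measurable (fun v => complex.Re (f (to_complex v))) /\
  bdd_measurable (fun v => complex.Im (f (to_complex v))).

Lemma eq_admissible f1 f2 :
  (forall v, circle v -> f1 (to_complex v) = f2 (to_complex v)) ->
  admissible f1 -> admissible f2.
Proof.
by move=> e [r i]; split; [apply: eq_bdd_measurable r|apply: eq_bdd_measurable i] => v cv;
  rewrite e.
Qed.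

Lemma Rec_mul (x y : C) : complex.Re (x * y) =
  complex.Re x * complex.Re y - complex.Im x * complex.Im y.
Proof. by case: x y => [? ?] [? ?]. Qed.
Lemma Imc_mul (x y : C) : complex.Im (x * y) =
  complex.Re x * complex.Im y + complex.Im x * complex.Re y.
Proof. by case: x y => [? ?] [? ?]. Qed.
Lemma Rec_add (x y : C) : complex.Re (x + y) = complex.Re x + complex.Re y.
Proof. by case: x y => [? ?] [? ?]. Qed.
Lemma Imc_add (x y : C) : complex.Im (x + y) = complex.Im x + complex.Im y.
Proof. by case: x y => [? ?] [? ?]. Qed.

Lemma admissible_cst k : admissible (fun=> k).
Proof. by split; exact: bdd_measurable_cst. Qed.

Lemma admissible_id : admissible id.
Proof. by split; [exact: bdd_measurable_fst|exact: bdd_measurable_snd]. Qed.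

Lemma admissibleD f1 f2 : admissible f1 -> admissible f2 ->
  admissible (fun x => f1 x + f2 x).
Proof.
move=> [r1 i1] [r2 i2]; split.
  by under eq_fun do rewrite Rec_add; exact: bdd_measurableD.
by under eq_fun do rewrite Imc_add; exact: bdd_measurableD.
Qed.

Lemma admissibleM f1 f2 : admissible f1 -> admissible f2 ->
  admissible (fun x => f1 x * f2 x).
Proof.
move=> [r1 i1] [r2 i2]; split.
  under eq_fun do rewrite Rec_mul.
  by apply: bdd_measurableD; [|apply: bdd_measurableN]; exact: bdd_measurableM.
under eq_fun do rewrite Imc_mul.
by apply: bdd_measurableD; exact: bdd_measurableM.
Qed.

Lemma admissible_sum n (F : 'I_n -> C -> C) :
  (forall i, admissible (F i)) -> admissible (fun x => \sum_(i < n) F i x).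
Proof.
elim: n F => [|n IH] F aF.
  by under eq_fun do rewrite big_ord0; exact: admissible_cst.
by under eq_fun do rewrite big_ord_recl; apply: admissibleD => //; exact: IH.
Qed.

Lemma admissible_prod n (F : 'I_n -> C -> C) :
  (forall i, admissible (F i)) -> admissible (fun x => \prod_(i < n) F i x).
Proof.
elim: n F => [|n IH] F aF.
  by under eq_fun do rewrite big_ord0; exact: admissible_cst.
by under eq_fun do rewrite big_ord_recl; apply: admissibleM => //; exact: IH.
Qed.

Lemma admissibleX f n : admissible f -> admissible (fun x => f x ^+ n).
Proof.
move=> af; elim: n => [|n IH]; first exact: admissible_cst.
by under eq_fun do rewrite exprS; exact: admissibleM.
Qed.

Lemma to_complex_norm (v : T) : circle v -> `|to_complex v| = 1.
Proof. by rewrite /unit_circle /= normc_def /= => ->; rewrite sqrtr1. Qed.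

Lemma to_complex_neq0 (v : T) : circle v -> to_complex v != 0.
Proof. by move=> /to_complex_norm e; rewrite -normr_eq0 e oner_eq0. Qed.

Lemma Rec_inv (x : C) : complex.Re x^-1 =
  complex.Re x * (complex.Re x ^+ 2 + complex.Im x ^+ 2)^-1.
Proof. by case: x. Qed.
Lemma Imc_inv (x : C) : complex.Im x^-1 =
  - complex.Im x * (complex.Re x ^+ 2 + complex.Im x ^+ 2)^-1.
Proof. by case: x => a b; rewrite /= mulNr. Qed.

(** Both parts of [1 / f] are parts of the conjugate of [f] over [|f| ^ 2], a denominator that stays
    above [e ^+ 2]. *)
Lemma admissibleV f (e : R) : 0 < e ->
  (forall v, circle v -> e%:C <= `|f (to_complex v)|)%C ->
  admissible f -> admissible (fun x => (f x)^-1).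
Proof.
move=> e0 ef [rf imf].
have bV : bdd_measurable (fun v =>
    (complex.Re (f (to_complex v)) ^+ 2 + complex.Im (f (to_complex v)) ^+ 2)^-1).
  apply: (@bdd_measurableV _ (e ^+ 2)); first by rewrite exprn_gt0.
    move=> v /ef; rewrite -lecR -[X in _ -> _ <= X]/_%:C%C add_Re2_Im2 rmorphXn /= => h.
    by rewrite ler_pXn2r// nnegrE ?normr_ge0 ?ler0c ?ltW.
  by apply: bdd_measurableD; under eq_fun do rewrite expr2; exact: bdd_measurableM.
split.
  by under eq_fun do rewrite Rec_inv; exact: bdd_measurableM.
by under eq_fun do rewrite Imc_inv; apply: bdd_measurableM => //; exact: bdd_measurableN.
Qed.

Lemma admissible_inv : admissible (fun x => x^-1).
Proof.
apply: (@admissibleV id 1) => //; last exact: admissible_id.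
by move=> v cv; rewrite to_complex_norm.
Qed.

Lemma admissible_subV (z : C) : `|z| != 1 -> admissible (fun x => (x - z)^-1).
Proof.
(* The lower bound is the distance [|1 - |z||] from [z] to the circle. The norm is valued in
   [complex R], so its real part serves as [e]. *)
move=> z1; have [e ez e0] : exists2 e : R, `|1 - `|z| | = e%:C%C & 0 < e.
  exists (complex.Re `|1 - `|z| |); first by rewrite RRe_real// normr_real.
  have h : 0 < `|1 - `|z| | by rewrite normr_gt0 subr_eq0 eq_sym.
  by rewrite -ltcR RRe_real// normr_real.
apply: (admissibleV e0) => [v cv|]; last first.
  by apply: admissibleD; [exact: admissible_id|exact: admissible_cst].
by rewrite -ez -(to_complex_norm cv); exact: ler_dist_dist.
Qed.

Section Measure.
Variable mu : cmeasure R.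

Lemma eq_circle_int f1 f2 :
  (forall v, circle v -> f1 (to_complex v) = f2 (to_complex v)) ->
  circle_int mu f1 = circle_int mu f2.
Proof.
by move=> e; rewrite /circle_int; congr (Complex (_ - _) (_ + _));
  apply: eq_charge_int => v cv; rewrite e.
Qed.

Lemma circle_intD f1 f2 : admissible f1 -> admissible f2 ->
  circle_int mu (fun x => f1 x + f2 x) = circle_int mu f1 + circle_int mu f2.
Proof.
move=> [r1 i1] [r2 i2]; rewrite /circle_int.
under [X in charge_int (re_part _) X]eq_fun do rewrite Rec_add.
under [X in charge_int (im_part _) X]eq_fun do rewrite Imc_add.
under [X in Complex _ (charge_int (re_part _) X + _)]eq_fun do rewrite Imc_add.
under [X in Complex _ (_ + charge_int (im_part _) X)]eq_fun do rewrite Rec_add.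
rewrite !charge_intD//; apply/eqP; rewrite eq_complex /=.
by apply/andP; split; apply/eqP; ring.
Qed.

Lemma circle_intZ k f : admissible f ->
  circle_int mu (fun x => k * f x) = k * circle_int mu f.
Proof.
case: k => a b [rf imf]; rewrite /circle_int.
set u := fun v => complex.Re (f (to_complex v)) in rf *.
set w := fun v => complex.Im (f (to_complex v)) in imf *.
have eR : (fun v => complex.Re (Complex a b * f (to_complex v))) = (fun v => a * u v + (- b) * w v).
  by apply/funext => v; rewrite Rec_mul mulNr.
have eI : (fun v => complex.Im (Complex a b * f (to_complex v))) = (fun v => a * w v + b * u v).
  by apply/funext => v; rewrite Imc_mul.
have bm := bdd_measurable_cst.
rewrite eR eI !charge_intD ?charge_intZ//; try by apply: bdd_measurableM.
apply/eqP; rewrite eq_complex /=.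
by apply/andP; split; apply/eqP; ring.
Qed.

Lemma circle_int_sum n (k : 'I_n -> C) (F : 'I_n -> C -> C) :
  (forall i, admissible (F i)) ->
  circle_int mu (fun x => \sum_(i < n) k i * F i x) = \sum_(i < n) k i * circle_int mu (F i).
Proof.
elim: n k F => [|n IH] k F aF.
  (* The zero integrand is written as a multiple by 0, so that homogeneity gives its integral. *)
  rewrite big_ord0; under eq_fun do rewrite big_ord0 -[0](mul0r 0).
  by rewrite circle_intZ ?mul0r//; exact: admissible_cst.
under eq_fun do rewrite big_ord_recl.
rewrite circle_intD; first by rewrite circle_intZ// IH// big_ord_recl.
  by apply: admissibleM => //; exact: admissible_cst.
by apply: admissible_sum => i; apply: admissibleM => //; exact: admissible_cst.
Qed.

End Measure.
End CircleIntegral.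

(** * The CMV ordering of the Laurent monomials *)

Section CMVExponents.
Variable K : fieldType.

(* The block of Z_[r] that carries the exponent t. *)
Definition cmv_index (t : int) : nat :=
  match t with Posz k => k.*2 | Negz k => k.*2.+1 end.

(** The inverse of [cmv_index]; [Negz h] is the integer [- (h + 1)]. *)
Definition cmv_exponent (r : nat) : int :=
  if odd r then Negz r./2 else Posz r./2.

Lemma cmv_power_index t (z : K) : cmv_power (cmv_index t) z = z ^ t.
Proof.
case: t => k; rewrite /cmv_power /= odd_double /= ?doubleK// uphalf_double.
by [].
Qed.

Lemma cmv_power_exponent r (z : K) : cmv_power r z = z ^ cmv_exponent r.
Proof. by rewrite /cmv_power /cmv_exponent; case: odd. Qed.

(** Consecutive exponents of one sign sit two blocks apart, so moving the exponent by at most [d]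
    either way raises the block by at most [2 * d]. This sets the width of the band. *)
Lemma cmv_index_shift r i d : (i <= 2 * d)%N ->
  (cmv_index (cmv_exponent r - d%:Z + i%:Z) <= r + 2 * d)%N.
Proof.
move=> i2d; rewrite /cmv_exponent.
move: (odd_double_half r); move: (r./2) => h; case: odd => /= <-; rewrite ?NegzE.
  case E : (_ + i%:Z) => [k|k] /=; move: E; rewrite ?NegzE -!mul2n; lia.
case E : (_ + i%:Z) => [k|k] /=; move: E; rewrite ?NegzE -!mul2n; lia.
Qed.

(** The exponents [-d, ..., d - 1] are exactly those of the first [2 * d] blocks. *)
Lemma cmv_index_lt i d : (i < 2 * d)%N -> (cmv_index (- d%:Z + i%:Z) < 2 * d)%N.
Proof.
by move=> i2d; case E : (_ + i%:Z) => [k|k] /=; move: E; rewrite ?NegzE -!mul2n; lia.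
Qed.

Lemma laurent_cmv (Q : {poly K}) s t (z : K) : (size Q <= s)%N -> z != 0 ->
  z ^ t * Q.[z] = \sum_(i < s) Q`_i * cmv_power (cmv_index (t + i%:Z)) z.
Proof.
move=> sQ z0; rewrite (horner_coef_wide _ sQ) mulr_sumr; apply: eq_bigr => i _.
by rewrite cmv_power_index expfzDr// mulrCA.
Qed.

End CMVExponents.

(** * Consequences of a Gauss-Borel factorization *)

Section GaussBorel.
Variable K : fieldType.
Variables M L U : nat -> nat -> K.
Hypothesis MLU : gauss_borel M L U.

Lemma gauss_borel_mul V i n : upper_triangular V ->
  mul_upper M V i n = mul_upper (tri_inv L) (mul_upper (tri_inv U) V) i n.
Proof.
case: MLU => _ uU _ dU eM uV; rewrite -mul_upperA//; last exact: upper_tri_inv.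
exact: eq_mul_upper.
Qed.

(** [M U = L^-1] is lower triangular. *)
Lemma gauss_borel_orthogonal i n : (i < n)%N -> mul_upper M U i n = 0.
Proof.
case: (MLU) => lL uU dL dU _ i_n; rewrite gauss_borel_mul//.
rewrite (@eq_mul_upper _ _ _ (tri_inv L) _ (fun k l => (k == l)%:R)) ?mul_upper1//.
  by have [lLi _] := lower_tri_inv lL dL; exact: lLi.
by move=> k; exact: mul_tri_invl.
Qed.

(** Forward substitution in [M V = L^-1 (U^-1 V)]: since [L^-1] is lower triangular with nonzero
    diagonal, zeros at the top of a column of [M V] pass row by row to [U^-1 V]. *)
Lemma gauss_borel_band V w n : upper_triangular V ->
  (forall i, (i + w < n)%N -> mul_upper M V i n = 0) ->
  forall i, (i + w < n)%N -> mul_upper (tri_inv U) V i n = 0.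
Proof.
case: (MLU) => lL uU dL dU _ uV MV i; have [lLi dLi] := lower_tri_inv lL dL.
elim/ltn_ind: i => i IH iwn; have := MV _ iwn; rewrite gauss_borel_mul//.
set N := mul_upper (tri_inv U) V in IH *.
have i_n : (i < n.+1)%N by rewrite ltnS ltnW// (leq_ltn_trans _ iwn)// leq_addr.
rewrite /mul_upper (bigD1 (Ordinal i_n)) //= big1 ?addr0.
  by move/eqP; rewrite mulf_eq0 (negbTE (dLi i)) => /eqP.
move=> k; rewrite -val_eqE /=; case: ltngtP => // ki _.
  by rewrite IH ?mulr0// (leq_ltn_trans _ iwn)// leq_add2r ltnW.
by rewrite lLi ?mul0r.
Qed.

End GaussBorel.

(** * Linear functionals and their moment matrices *)

Section Functionals.
Variable R : realType.
Local Notation C := (complex R).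

Lemma admissible_cmv_power k (f : C -> C) : admissible f ->
  admissible (fun x => (f x)^-1) -> admissible (fun x => cmv_power k (f x)).
Proof.
move=> af afV; rewrite /cmv_power; case: odd; last exact: admissibleX.
by under eq_fun do rewrite -exprVn; exact: admissibleX.
Qed.

Lemma admissible_Zcmv r k (e : 'I_r) (f : C -> C) : admissible f ->
  admissible (fun x => (f x)^-1) -> admissible (fun x => Zcmv (f x) k e).
Proof.
move=> af afV; rewrite /Zcmv; case: eqP => _; first exact: admissible_cmv_power.
exact: admissible_cst.
Qed.

Lemma admissible_ZcmvV r k (e : 'I_r) : admissible (fun x : C => Zcmv x^-1 k e).
Proof.
apply: admissible_Zcmv; first exact: admissible_inv.
by under eq_fun do rewrite invrK; exact: admissible_id.
Qed.

Lemma admissible_Apoly p U (a : 'I_p) n : admissible (fun x : C => Apoly U x^-1 a n).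
Proof.
apply: admissible_sum => k; apply: admissibleM; last exact: admissible_cst.
exact: admissible_ZcmvV.
Qed.

Lemma admissible_second_kind p U (a : 'I_p) n (z : C) : `|z| != 1 ->
  admissible (fun x => (z - x)^-1 * Apoly U x^-1 a n).
Proof.
move=> z1; apply: admissibleM; last exact: admissible_Apoly.
apply: (@eq_admissible _ (fun x => -1 * (x - z)^-1)) => [v _|].
  by rewrite -[to_complex v - z]opprB invrN mulN1r opprK.
by apply: admissibleM; [exact: admissible_cst|exact: admissible_subV].
Qed.

(** Shared by the measures and their perturbations. The case [n = 0] gives the value 0 at the zero
    function. *)
Definition linear_on_admissible (J : (C -> C) -> C) : Prop :=
  forall n (k : 'I_n -> C) (F : 'I_n -> C -> C), (forall i, admissible (F i)) ->
  J (fun x => \sum_(i < n) k i * F i x) = \sum_(i < n) k i * J (F i).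

(** The only nonzero entry in row [r * q + b] of [Z_[q]] is [cmv_power r] in column [b]. Vanishing
    entries of [M V] thus become orthogonality relations. *)
Lemma moment_mul p q (J : 'I_q -> 'I_p -> (C -> C) -> C)
    (linJ : forall b a, linear_on_admissible (J b a)) V r (b : 'I_q) n :
  mul_upper (moment J) V (r * q + b)%N n =
  \sum_(a < p) J b a (fun x => cmv_power r x * Apoly V x^-1 a n).
Proof.
have q0 : (0 < q)%N by apply: leq_ltn_trans (ltn_ord b).
set i := (r * q + b)%N; rewrite /mul_upper /moment.
transitivity (\sum_(b' < q) \sum_(a < p)
    J b' a (fun x => Zcmv x i b' * Apoly V x^-1 a n)).
  under eq_bigr do rewrite mulr_suml.
  rewrite exchange_big; apply: eq_bigr => b' _ /=.
  under eq_bigr do rewrite mulr_suml.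
  rewrite exchange_big; apply: eq_bigr => a _ /=.
  under eq_bigr do rewrite mulrC.
  rewrite -linJ => [|k]; last first.
    apply: admissibleM; last exact: admissible_ZcmvV.
    by apply: admissible_Zcmv; [exact: admissible_id|exact: admissible_inv].
  congr (J _ _ _); apply/funext => x; rewrite /Apoly /mul_upper mulr_sumr.
  by apply: eq_bigr => k _; ring.
rewrite (bigD1 b) //= [X in _ + X]big1 ?addr0 => [|b' b'b].
  apply: eq_bigr => a _; congr (J _ _ _); apply/funext => x.
  by rewrite /Zcmv /i modnMDl divnMDl// modn_small// eqxx divn_small// addn0.
apply: big1 => a _; have := linJ b' a 0%N (fun=> 0) (fun _ _ => 0) (fun=> admissible_cst 0).
rewrite !big_ord0 => h; rewrite -[RHS]h; congr (J _ _ _); apply/funext => x.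
by rewrite /Zcmv /i modnMDl modn_small// eq_sym val_eqE (negbTE b'b) mul0r.
Qed.

Lemma linear_circle_int (mu : cmeasure R) : linear_on_admissible (circle_int mu).
Proof. by move=> n k F; exact: circle_int_sum. Qed.

(** * The Geronimus perturbation and its connection matrix *)

Section Geronimus.
Variables (p q d : nat).
Variables (c : 'I_q -> C) (zeta : 'I_q -> 'I_(2 * d) -> C).
Variables (mu : 'I_q -> 'I_p -> cmeasure R).
Variables (m : 'I_q -> 'I_p -> 'I_(2 * d) -> C).
Hypothesis c_neq0 : forall b, c b != 0.
Hypothesis zeta_neq0 : forall b j, zeta b j != 0.
Hypothesis zeta_circle : forall b j, `|zeta b j| != 1.

Lemma Wlaurent_neq0 b v : unit_circle v -> Wlaurent c zeta b (to_complex v) != 0.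
Proof.
move=> cv; rewrite /Wlaurent !mulf_neq0 ?invr_eq0 ?expf_neq0 ?to_complex_neq0//.
apply/prodf_neq0 => j _; rewrite subr_eq0; apply: contraNneq (zeta_circle b j) => <-.
by rewrite to_complex_norm.
Qed.

Lemma admissible_WlaurentV b : admissible (fun x => (Wlaurent c zeta b x)^-1).
Proof.
under eq_fun do rewrite /Wlaurent invfM invfM invrK -prodfV.
apply: admissibleM; last by apply: admissible_prod => j; exact: admissible_subV.
apply: admissibleM; first exact: admissible_cst.
exact: admissibleX (admissible_id _).
Qed.

Lemma linear_geronimus b a : linear_on_admissible (geronimus c zeta mu m b a).
Proof.
move=> n k F aF; rewrite /geronimus.
transitivity (circle_int (mu b a) (fun x => \sum_(i < n) k i * (F i x * (Wlaurent c zeta b x)^-1))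
  + \sum_(j < 2 * d) \sum_(i < n) m b a j * (k i * F i (zeta b j))).
  congr (circle_int _ _ + _).
    by apply/funext => x; rewrite mulr_suml; apply: eq_bigr => i _; rewrite mulrA.
  by apply: eq_bigr => j _; rewrite mulr_sumr.
rewrite circle_int_sum => [|i]; last exact: admissibleM (admissible_WlaurentV b).
rewrite exchange_big -big_split; apply: eq_bigr => i _ /=.
by rewrite mulrDr mulr_sumr; congr (_ + _); apply: eq_bigr => j _; rewrite mulrCA.
Qed.

(** Neither the circle nor the mass points contain 0, so identities between Laurent expressions
    suffice away from 0. *)
Lemma eq_geronimus b a f g : (forall x, x != 0 -> f x = g x) ->
  geronimus c zeta mu m b a f = geronimus c zeta mu m b a g.
Proof.
move=> fg; congr (_ + _).
  by apply: eq_circle_int => v cv; rewrite fg// to_complex_neq0.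
by apply: eq_bigr => j _; rewrite fg.
Qed.

(* W_b kills the point masses, since they sit at its zeros. *)
Lemma geronimus_Wlaurent b a f :
  geronimus c zeta mu m b a (fun x => Wlaurent c zeta b x * f x) = circle_int (mu b a) f.
Proof.
rewrite /geronimus [X in _ + X]big1 ?addr0 => [|j _]; last first.
  by rewrite /Wlaurent (bigD1 j)//= subrr mul0r mulr0 mul0r mulr0.
by apply: eq_circle_int => v cv; rewrite mulrAC mulfV ?mul1r// Wlaurent_neq0.
Qed.

Variables (L U Lc Uc : nat -> nat -> C).
Hypothesis hM : gauss_borel (moment (fun b a => circle_int (mu b a))) L U.
Hypothesis hMc : gauss_borel (moment (geronimus c zeta mu m)) Lc Uc.

(** Every monomial of [x ^ t * Q] lies in a row of [Z_[q]] before row [n], where column [n] of the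
    perturbed moment matrix times [Uc] vanishes. *)
Lemma laurent_orthogonal (Q : {poly C}) s t (b : 'I_q) n : (size Q <= s)%N ->
  (forall i : 'I_s, (cmv_index (t + i%:Z) * q + b < n)%N) ->
  \sum_(a < p) geronimus c zeta mu m b a (fun x => x ^ t * Q.[x] * Apoly Uc x^-1 a n) = 0.
Proof.
move=> sQ hn.
transitivity (\sum_(a < p) \sum_(i < s) Q`_i * geronimus c zeta mu m b a
    (fun x => cmv_power (cmv_index (t + i%:Z)) x * Apoly Uc x^-1 a n)).
  apply: eq_bigr => a _; rewrite -linear_geronimus => [|i]; last first.
    apply: admissibleM; last exact: admissible_Apoly.
    by apply: admissible_cmv_power; [exact: admissible_id|exact: admissible_inv].
  apply: eq_geronimus => x x0; rewrite (laurent_cmv _ sQ x0) mulr_suml.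
  by apply: eq_bigr => i _; rewrite mulrA.
rewrite exchange_big big1// => i _; rewrite -mulr_sumr.
by rewrite -(moment_mul linear_geronimus) (gauss_borel_orthogonal hMc) ?mulr0.
Qed.

Lemma size_prod_XsubC_ord (k : nat) (P : pred 'I_k) (f : 'I_k -> C) :
  size (\prod_(j | P j) ('X - (f j)%:P)) = (#|P|).+1.
Proof.
rewrite (_ : \prod_(j | P j) _ = \prod_(j <- enum P) ('X - (f j)%:P)).
  by rewrite size_prod_XsubC cardE.
by rewrite big_enum.
Qed.

Lemma connection_band i n : (i + 2 * d * q < n)%N -> mul_upper (tri_inv U) Uc i n = 0.
Proof.
case: (hMc) => _ uUc _ _ _.
apply: (gauss_borel_band hM uUc) => {}i iwn.
case: (posnP q) => q0.
  rewrite /mul_upper big1// => k _; rewrite /moment big1 ?mul0r// => b _.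
  by exfalso; have := ltn_ord b; rewrite [X in (_ < X)%N]q0.
pose b := Ordinal (ltn_pmod i q0); pose r := (i %/ q)%N.
have ei : i = (r * q + b)%N by exact: divn_eq.
rewrite ei (moment_mul (fun b a => linear_circle_int (mu b a))).
(* [Q] is [x ^ d] times [W_b], a polynomial of degree [2 * d]. *)
pose Q := c b *: \prod_(j < 2 * d) ('X - (zeta b j)%:P).
have sQ : (size Q <= (2 * d).+1)%N.
  by rewrite (leq_trans (size_scale_leq _ _))// size_prod_XsubC_ord card_ord.
have hn (k : 'I_(2 * d).+1) : (cmv_index (cmv_exponent r - d%:Z + k%:Z) * q + b < n)%N.
  apply: leq_ltn_trans iwn; rewrite ei addnAC leq_add2r -mulnDl leq_mul2r.
  by rewrite cmv_index_shift ?orbT// -ltnS ltn_ord.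
rewrite -[RHS](laurent_orthogonal sQ hn); apply: eq_bigr => a _.
rewrite -geronimus_Wlaurent; apply: eq_geronimus => x x0; rewrite mulrA; congr (_ * _).
rewrite cmv_power_exponent expfzDr// -exprnN hornerZ horner_prod /Wlaurent.
under [in RHS]eq_bigr do rewrite hornerXsubC.
by ring.
Qed.

Lemma Apoly_connection w (a : 'I_p) n :
  Apoly Uc w a n = \sum_(k < n.+1) mul_upper (tri_inv U) Uc k n * Apoly U w a k.
Proof.
case: (hM) (hMc) => _ uU _ dU _ [_ uUc _ _ _].
have uN := upper_mul_upper (upper_tri_inv uU dU) uUc.
transitivity (mul_upper (Apoly U w) (mul_upper (tri_inv U) Uc) a n); last first.
  by apply: eq_bigr => k _; rewrite mulrC.
rewrite /Apoly mul_upperA//; apply: eq_mul_upper => // k.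
rewrite -mul_upperA//; last exact: upper_tri_inv.
rewrite (@eq_mul_upper _ _ _ (fun k l => (k == l)%:R) _ Uc)// => [|l].
  (* The sum stops at [n]; for [k > n] it misses the index [k], but then [Uc k n] is 0 as well. *)
  rewrite /mul_upper; case: (ltnP n k) => nk.
    by rewrite uUc// big1// => l _; rewrite gtn_eqF ?mul0r// (leq_trans (ltn_ord l)).
  have kn : (k < n.+1)%N by [].
  rewrite (bigD1 (Ordinal kn)) //= eqxx mul1r big1 ?addr0// => l.
  by rewrite -val_eqE /= eq_sym => /negbTE ->; rewrite mul0r.
exact: mul_tri_invr.
Qed.

(** By linearity, [Fentry] is minus the pairing of row [b] of the perturbation with [A_k] times
    [W_b(x) / (x - zeta b j)]: the integral is the second kind function up to sign, and only the
    mass at [zeta b j] survives. *)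
Lemma Fentry_kernel n (b : 'I_q) j : (2 * d * q <= n)%N ->
  \sum_(k < n.+1) mul_upper (tri_inv U) Uc k n * Fentry c zeta mu m U k b j = 0.
Proof.
move=> dn; set N := mul_upper _ _; set z := zeta b j.
pose Q := c b *: \prod_(s < 2 * d | s != j) ('X - (zeta b s)%:P).
have d0 : (0 < 2 * d)%N by apply: leq_ltn_trans (ltn_ord j).
have sQ : (size Q <= 2 * d)%N.
  rewrite (leq_trans (size_scale_leq _ _))// size_prod_XsubC_ord.
  by rewrite cardC1 card_ord prednK.
(* Dividing [W_b] by one factor leaves the exponents [-d, ..., d - 1], so all rows stay below
   [2 * d * q]. *)
have hn (k : 'I_(2 * d)) : (cmv_index (- d%:Z + k%:Z) * q + b < n)%N.
  apply: leq_trans dn; apply: leq_trans (_ : _ <= (cmv_index (- d%:Z + k%:Z)).+1 * q)%N _.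
    by rewrite [X in (_ < X)%N]mulSn [X in (_ < X)%N]addnC ltn_add2l.
  by rewrite leq_mul2r cmv_index_lt ?orbT.
have QE x : x ^ (- d%:Z) * Q.[x] = c b * x ^- d * \prod_(s < 2 * d | s != j) (x - zeta b s).
  rewrite hornerZ horner_prod -exprnN mulrCA mulrA; congr (_ * _).
  by apply: eq_bigr => s _; rewrite hornerXsubC.
have QW x : Wlaurent c zeta b x = x ^ (- d%:Z) * Q.[x] * (x - z).
  by rewrite QE /Wlaurent (bigD1 j)//= mulrCA mulrC.
(* Second kind functions use [(z - x)^-1] while the quotient gives [(x - z)^-1], so the sum is
   matched with its negative. *)
have := laurent_orthogonal sQ hn; rewrite -[X in _ -> X = _]opprK => h.
apply/eqP; rewrite oppr_eq0; apply/eqP; rewrite -[RHS]h.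
have -> : \sum_(k < n.+1) N k n * Fentry c zeta mu m U k b j =
  \sum_(a < p) (circle_int (mu b a) (fun x => (z - x)^-1 * Apoly Uc x^-1 a n)
    - z ^ (- d%:Z) * Q.[z] * m b a j * Apoly Uc z^-1 a n).
  under eq_bigr do rewrite /Fentry /second_kind -/z mulrBr !mulr_sumr -sumrB.
  rewrite exchange_big; apply: eq_bigr => a _ /=; rewrite sumrB; congr (_ - _); last first.
    rewrite Apoly_connection mulr_sumr.
    by apply: eq_bigr => k _; rewrite QE -/N [RHS]mulrCA.
  rewrite -circle_int_sum => [|k]; last exact: admissible_second_kind (zeta_circle b j).
  apply: eq_circle_int => v _; rewrite Apoly_connection mulr_sumr.
  by apply: eq_bigr => k _; rewrite mulrCA.
rewrite -sumrN; apply: eq_bigr => a _; rewrite opprB addrC /geronimus; congr (_ + _); last first.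
  (* [Q] vanishes at the zeros of [W_b] other than [zeta b j]. *)
  rewrite (bigD1 j) //= [X in _ + X]big1 ?addr0 => [|s sj]; first by ring.
  by rewrite QE (bigD1 s)//= subrr mul0r mulr0 mul0r mulr0.
rewrite -mulN1r -circle_intZ; last exact: admissible_second_kind (zeta_circle b j).
apply: eq_circle_int => v cv; have Wv := Wlaurent_neq0 b cv.
set x := to_complex v in Wv *; move: Wv; rewrite QW mulf_eq0 negb_or => /andP[P0 xz].
rewrite -[z - x]opprB invrN mulN1r mulNr opprK.
by rewrite -mulf_div mulfV// mul1r mulrC.
Qed.

End Geronimus.
End Functionals.

(** * Assembly of the two determinantal formulas *)

Theorem proposition4p7 (R : realType) (p q d : nat)
  (hp : (0 < p)%N) (hq : (0 < q)%N) (hd : (0 < d)%N)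
  (mu : 'I_q -> 'I_p -> cmeasure R)
  (mu_circle : forall b a, on_circle (mu b a))
  (mu_supp : forall b a, infinite_set (csupport (mu b a)))
  (c : 'I_q -> complex R) (zeta : 'I_q -> 'I_(2 * d) -> complex R)
  (c_neq0 : forall b, c b != 0)
  (zeta_neq0 : forall b j, zeta b j != 0)
  (zeta_inj : forall b j b' j', zeta b j = zeta b' j' -> b = b' /\ j = j')
  (zeta_circle : forall b j, `|zeta b j| != 1)
  (m : 'I_q -> 'I_p -> 'I_(2 * d) -> complex R)
  (L U Lc Uc : nat -> nat -> complex R)
  (hM : gauss_borel (moment (fun b a => circle_int (mu b a))) L U)
  (hMc : gauss_borel (moment (geronimus c zeta mu m)) Lc Uc) :
  let NG := mul_upper (tri_inv U) Uc in
  forall (l : nat) (a : 'I_p) (z : complex R), z != 0 ->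
    let n := (l + 2 * d * q)%N in
    (Fdet c zeta mu m U l != 0 ->
       (NG n n)^-1 * Apoly Uc z^-1 a n =
       FAdet c zeta mu m U l a z / Fdet c zeta mu m U l) /\
    (Fdet c zeta mu m U l.+1 != 0 ->
       (NG l n)^-1 * Apoly Uc z^-1 a n =
       FAdet c zeta mu m U l a z / Fdet c zeta mu m U l.+1).
Proof.
move=> NG l a z _ n; have [_ uU _ dU _] := hM; have [_ uUc _ dUc _] := hMc.
pose s := (q * (2 * d))%N.
have en : n = (l + s)%N by rewrite /n /s [(q * _)%N]mulnC.
have band k : (k < l)%N -> NG k n = 0.
  move=> kl; apply: (connection_band c_neq0 zeta_neq0 zeta_circle hM hMc).
  by rewrite ltn_add2r.
have NGnn : NG n n != 0.
  rewrite /NG mul_upper_diag; last exact: upper_tri_inv.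
  by rewrite mulf_neq0// tri_inv_diag_neq0.
pose F k := Frow c zeta mu m U (l + k).
pose v k := NG (l + k)%N n; pose y k := Apoly U z^-1 a (l + k)%N.
have vF : \sum_(k < s + 1) v k *: F k = 0.
  (* The rows before [l] carry zero coefficients, so the sum extends to the whole column [n] of
     [NG]. *)
  rewrite -(@big_ord_shift _ (fun k => NG k n *: Frow c zeta mu m U k)) => [|k kl].
    rewrite -en; apply/rowP => i; case/mxvec_indexP: i => b j.
    rewrite summxE mxE.
    rewrite -[RHS](Fentry_kernel c_neq0 zeta_neq0 zeta_circle hM hMc (n := n) b j)
      ?leq_addl//.
    by apply: eq_bigr => k _; rewrite mxE mxvecE mxE.
  by rewrite band// scale0r.
have vy : \sum_(k < s + 1) v k * y k = Apoly Uc z^-1 a n.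
  rewrite (Apoly_connection hM hMc).
  rewrite -(@big_ord_shift _ (fun k => NG k n * Apoly U z^-1 a k)) -?en// => k kl.
  by rewrite band// mul0r.
have os : ~~ odd s by rewrite /s oddM oddM andbF.
(* Deleting the first row leaves the rows [l + 1, ..., n], hence the shifted denominator when
   dividing by [NG l n]. *)
have Fl1 : Fdet c zeta mu m U l.+1 = \det (\matrix_(r < s) F r.+1).
  congr determinant; apply/matrixP => i j; rewrite !mxE /F.
  by rewrite addSnnS.
split=> dF.
  have := kernel_row_cramer_last vF vy.
  rewrite -/(FAdet c zeta mu m U l a z) -/(Fdet c zeta mu m U l) /v -en => e.
  by apply: (mulfI NGnn); rewrite mulrA mulfV// mul1r mulrA [NG n n * _]mulrC e mulfK.
have := kernel_row_cramer_first vF vy os.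
rewrite -Fl1 -/(FAdet c zeta mu m U l a z) /v addn0 => e.
(* The extreme superdiagonal entry is nonzero because the diagonal entry [NG n n] and the
   denominator are. *)
have NGln : NG l n != 0.
  have := kernel_row_neq0 vF; rewrite /v -en addn0 -Fl1; exact.
by apply: (mulfI NGln); rewrite mulrA mulfV// mul1r mulrA [NG l n * _]mulrC e mulfK.
Qed.
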